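(* Let $G=(V,E)$ be a finite connected simple graph, and consider the two-player guessing game on $G$ in either the simultaneous or the alternating variant. There exists a correct strategy under which, for every placement, at least one of the two players eventually announces their position, if and only if $G$ is a tree.
   Context: The game: two players $A$ and $B$ are placed on the endpoints of an edge; a placement is an ordered pair $(a,b)$ with $\{a,b\}\in E$, meaning $A$ sits at $a$ and $B$ at $b$. Each player knows $G$ and the vertex of the other player, but not their own vertex. Time proceeds in discrete steps $t=1,2,\dots$. In the simultaneous variant, at each step each player either stays silent or announces a vertex (claiming it is their own position), both acting at the same time. In the alternating variant, $A$ may speak only at odd steps and $B$ only at even steps. All announcements are heard by both players. A strategy specifies for each player, as a function of $G$, the other player's vertex and the history of announcements so far, whether to stay silent or which vertex to announce at each step (the players may have agreed on it in advance). A strategy is correct if in every placement, whenever a player announces a vertex, it is that player's actual position. *)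

(* Defs.v *)
From mathcomp Require Import all_boot.

Set Implicit Arguments.
Unset Strict Implicit.
Unset Printing Implicit Defensive.

Section Graphs.
Variables (T : finType) (e : rel T).

(* The empty graph is not connected. *)
Definition connected_graph : Prop :=
  0 < #|T| /\ forall x y : T, connect e x y.

(* [ucycle e c] says that [c] is a duplicate-free cyclic e-sequence. In a
   simple graph the sequences [::] and [:: x; y], with xy an edge, satisfy it
   without being graph cycles, whence the bound 2. *)
Definition acyclic_graph : Prop :=
  forall c : seq T, ucycle e c -> size c <= 2.

Definition is_tree : Prop := connected_graph /\ acyclic_graph.

End Graphs.

Inductive variant := Simultaneous | Alternating.

Inductive player := PlayerA | PlayerB.

(* Time steps are numbered from 1. *)
Definition may_speak (v : variant) (p : player) (t : nat) : bool :=
  match v, p with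
  | Simultaneous, _ => true
  | Alternating, PlayerA => odd t
  | Alternating, PlayerB => ~~ odd t
  end.

Section Game.
Variables (T : finType) (e : rel T).

(* What A and B do at one step, in this order; [None] is silence. *)
Definition round : Type := option T * option T.

(* The rounds of the steps 1, 2, ..., size h, in chronological order. *)
Definition history : Type := seq round.

(* [s p x h] is the action of player [p] who sees the other player at [x],
   at step (size h).+1, after the history [h]. *)
Definition strategy : Type := player -> T -> history -> option T.

Definition legal (v : variant) (s : strategy) : Prop :=
  forall (p : player) (x : T) (h : history),
    ~~ may_speak v p (size h).+1 -> s p x h = None.

(* A placement (a, b) puts A at a and B at b. *)
Definition placement (ab : T * T) : bool := e ab.1 ab.2.

Definition own_vertex (ab : T * T) (p : player) : T :=
  if p is PlayerA then ab.1 else ab.2.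

Definition seen_vertex (ab : T * T) (p : player) : T :=
  if p is PlayerA then ab.2 else ab.1.

(* The history of the first [t] steps of the play. *)
Fixpoint play (s : strategy) (ab : T * T) (t : nat) : history :=
  if t is t'.+1 then
    let h := play s ab t' in
    rcons h (s PlayerA (seen_vertex ab PlayerA) h,
             s PlayerB (seen_vertex ab PlayerB) h)
  else [::].

(* Player [p] announces the vertex [x] at step t.+1. *)
Definition announces (s : strategy) (ab : T * T) (p : player) (t : nat) (x : T)
  : Prop := s p (seen_vertex ab p) (play s ab t) = Some x.

Definition correct (s : strategy) : Prop :=
  forall ab, placement ab ->
  forall p t x, announces s ab p t x -> x = own_vertex ab p.

Definition someone_announces (s : strategy) : Prop :=
  forall ab, placement ab -> exists p t x, announces s ab p t x.

End Game.

(* Main.v *)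
Require Import Defs.
From mathcomp Require Import all_boot.
From mathcomp Require Import zify.

(** On a set of vertices of which each has two neighbours in the set, silence
    never ends: after a silent history, a player who sees such a vertex cannot
    choose between its two neighbours. The vertices of a cycle form such a set.
    An acyclic graph has no nonempty set of this kind, so its vertices can be
    ranked in such a way that each has at most one neighbour of higher rank.
    A player who sees [x] then waits for a time that increases with the rank of
    [x], and if nobody has spoken, announces the higher neighbour of [x]: a
    player at a lower neighbour would have been told so earlier by the partner
    having announced [x]. *)

Set Implicit Arguments.
Unset Strict Implicit.
Unset Printing Implicit Defensive.

Section Peeling.
Variables (T : finType) (e : rel T).
Hypotheses (e_sym : symmetric e) (e_irr : irreflexive e).

Definition no_leaf (A : {pred T}) : Prop :=
  forall x, x \in A -> exists y z, [/\ y \in A, z \in A, e x y, e x z & y != z].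

Lemma no_leaf_ucycle (c : seq T) : ucycle e c -> 2 < size c -> no_leaf (mem c).
Proof.
move=> cyc_c size_c x /[dup] c_x /rot_to[i c' rot_c].
have memE y : (y \in mem c) = (y \in x :: c') by rewrite -rot_c mem_rot.
move: cyc_c size_c; rewrite -(rot_ucycle i) -(size_rot i) rot_c.
case: c' memE {rot_c} => [|y [|z q]] // memE /andP[cyc uniq_c] _.
(* With [x] rotated to the front, its two neighbours on the cycle are the second and the last
   vertex; length above 2 keeps them apart. *)
exists y, (last z q); rewrite !memE; split.
- by rewrite !inE eqxx orbT.
- by rewrite 2!inE mem_last !orbT.
- by case/andP: cyc.
- by rewrite e_sym; move: cyc; rewrite /= rcons_path => /and4P[].
- move: uniq_c; rewrite !cons_uniq => /and3P[_ y_new _].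
  by apply: contraNneq y_new => ->; apply: mem_last.
Qed.

(** Otherwise the stretch of the path from [x] to [w], closed by the edge between them, would be a
    cycle on at least three vertices. *)
Lemma acyclic_back_edge (x w : T) (p : seq T) :
  acyclic_graph e -> path e x p -> uniq (x :: p) -> e x w -> w \in p ->
  w = head x p.
Proof.
move=> acyc + + xw /splitPr p_w; case: p_w => p1 p2.
rewrite -cat_rcons cat_path -cat_cons cat_uniq => /andP[p1_path _].
move=> /andP[p1_uniq _].
have/acyc: ucycle e (x :: rcons p1 w).
  by rewrite /ucycle p1_uniq /= rcons_path p1_path last_rcons e_sym xw.
by case: p1 {p1_path p1_uniq} => //= y p1; rewrite size_rcons.
Qed.

(** A simple path starting in [A] could be prolonged at its front forever: of two neighbours of the
    front in [A], at most one is already on the path. Its length would exceed [#|T|]. *)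
Lemma acyclic_no_leaf (A : {pred T}) :
  acyclic_graph e -> no_leaf A -> A =i pred0.
Proof.
move=> acyc deg2 x0; apply/negbTE/negP=> Ax0.
have long n : exists x p,
    [/\ x \in A, path e x p, uniq (x :: p) & size p = n].
  elim: n => [|n [x [p [Ax xp up sz_p]]]]; first by exists x0, [::].
  suff [w [Aw xw w_new]] : exists w, [/\ w \in A, e x w & w \notin x :: p].
    by exists w, (x :: p); rewrite cons_uniq w_new up /= e_sym xw sz_p.
  have [y [z [Ay Az xy xz y_neq_z]]] := deg2 x Ax.
  have old w : e x w -> w \in x :: p -> w = head x p.
    move=> xw; rewrite inE => /predU1P[wx|]; first by rewrite wx e_irr in xw.
    exact: acyclic_back_edge.
  case: (boolP (y \in x :: p)) => [/(old y xy) y_head|]; last by exists y.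
  case: (boolP (z \in x :: p)) => [/(old z xz) z_head|]; last by exists z.
  by rewrite y_head z_head eqxx in y_neq_z.
have [x [p [_ _ up sz_p]]] := long #|T|.
by have := max_card (mem (x :: p)); rewrite (card_uniqP up) /= sz_p ltnn.
Qed.

Lemma acyclic_ranking_in (A : {set T}) :
  acyclic_graph e ->
  exists f : T -> nat, {in A &, injective f} /\
    {in A & &, forall x y z, e x y -> e x z -> f x < f y -> f x < f z -> y = z}.
Proof.
move=> acyc; have [n] := ubnP #|A|; elim: n A => // n IHn A leAn.
have [->|[a0 Aa0]] := set_0Vmem A.
  by exists (fun=> 0); split=> [x y|x y z]; rewrite inE.
pose leaf x := [forall y in A, forall z in A, e x y && e x z ==> (y == z)].
have /exists_inP[a Aa leaf_a] : [exists x in A, leaf x].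
  apply: contraT => /exists_inPn no_lf.
  suff/(acyclic_no_leaf acyc)/(_ a0): no_leaf (mem A) by rewrite Aa0.
  move=> x /no_lf /forall_inPn[y Ay /forall_inPn[z Az]].
  by rewrite negb_imply => /andP[/andP[xy xz] yz]; exists y, z.
have [|f [f_inj f_up]] := IHn (A :\ a); first by rewrite (cardsD1 a) Aa in leAn.
have inD x : x \in A -> x != a -> x \in A :\ a by rewrite !inE => -> ->.
(* The peeled leaf [a] gets the lowest rank, so it is never a higher neighbour, and the ranks of the
   other vertices keep their order. *)
exists (fun x => if x == a then 0 else (f x).+1); split=> [x y Ax Ay|].
  case: eqVneq => [->|xa]; case: eqVneq => [->|ya] // [].
  by apply: f_inj; apply: inD.
move=> x y z Ax Ay Az xy xz.
case: eqVneq => [xa _ _|xa].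
  have /forall_inP/(_ _ Ay)/forall_inP/(_ _ Az) := leaf_a.
  by rewrite -xa xy xz => /eqP.
case: eqVneq => // ya; case: eqVneq => // za.
by rewrite !ltnS; apply: f_up xy xz; apply: inD.
Qed.

Lemma acyclic_ranking :
  acyclic_graph e ->
  exists (f : T -> nat) (par : T -> T),
    injective f /\ forall x y, e x y -> f x < f y -> par x = y.
Proof.
move=> /(acyclic_ranking_in setT)[f [f_inj f_up]].
(* The default [x] is used only at vertices without a higher neighbour, where nothing is required of
   [par]. *)
exists f, (fun x => odflt x [pick y | e x y && (f x < f y)]); split=> [x y|x y].
  by apply: f_inj; rewrite inE.
move=> xy fxy; case: pickP => [z /andP[xz fxz]|/(_ y)]; last by rewrite xy fxy.
by apply: (f_up x); rewrite ?inE.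
Qed.

End Peeling.

Section Strategies.
Variables (T : finType) (e : rel T).
Hypothesis e_sym : symmetric e.

Definition silence (n : nat) : history T := nseq n (None, None).

Lemma silenceS n : silence n.+1 = rcons (silence n) (None, None).
Proof. by rewrite /silence -addn1 nseqD cats1. Qed.

Lemma size_play (s : strategy T) ab t : size (play s ab t) = t.
Proof. by elim: t => //= t IHt; rewrite size_rcons IHt. Qed.

Lemma play_silent_le (s : strategy T) ab t u :
  u <= t -> play s ab t = silence t -> play s ab u = silence u.
Proof.
move/subnK<-; elim: (t - u) => // n IHn.
by rewrite addSn silenceS => /rcons_inj[/IHn].
Qed.

Lemma no_leaf_silent (s : strategy T) (A : {pred T}) :
  correct e s -> no_leaf e A ->
  forall t, {in A &, forall a b, e a b -> play s (a, b) t = silence t}.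
Proof.
move=> s_ok deg2; elim=> // t IHt a b Aa Ab ab.
have mute p x : x \in A -> s p x (silence t) = None.
  move=> Ax; case sx: (s p x _) => [w|] //.
  have [y [z [Ay Az xy xz]]] := deg2 x Ax.
  (* By induction, every placement in [A] with [x] seen yields the same silent history, so the
     announced [w] would have to equal both [y] and [z]. *)
  suff at_w u : u \in A -> e x u -> w = u by rewrite -(at_w y) // -(at_w z) ?eqxx.
  move=> Au xu; case: p sx => sx.
    apply: (s_ok (u, x) _ PlayerA t); first by rewrite /placement /= e_sym.
    by rewrite /announces IHt // e_sym.
  apply: (s_ok (x, u) _ PlayerB t) => //.
  by rewrite /announces IHt.
by rewrite silenceS /= IHt // !mute.
Qed.

Lemma winning_acyclic (s : strategy T) :
  correct e s -> someone_announces e s -> acyclic_graph e.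
Proof.
move=> s_ok s_win c cyc_c; rewrite leqNgt; apply/negP=> size_c.
have deg2 := no_leaf_ucycle e_sym cyc_c size_c.
have mute := no_leaf_silent s_ok deg2.
case: c cyc_c size_c deg2 mute => // x c _ _ deg2 mute.
have Cx : x \in mem (x :: c) by apply: mem_head.
have [y [_ [Cy _ xy _ _]]] := deg2 x Cx.
have [p [t [w sw]]] := s_win (x, y) xy.
have := mute t.+1 x y Cx Cy xy; rewrite silenceS => /rcons_inj[].
by case: p sw => /= sw _ sA sB; rewrite /announces /= in sw;
  rewrite sw in sA sB.
Qed.

Variables (f : T -> nat) (par : T -> T).
Hypotheses (f_inj : injective f)
  (par_up : forall x y, e x y -> f x < f y -> par x = y).

(* Different parities for the two players keep the strategy legal in the
   alternating variant. *)
Definition delay (p : player) (x : T) : nat :=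
  (f x).*2 + (if p is PlayerA then 0 else 1).

(** A single comparison tests both that the waiting time is exactly over and that nobody has
    spoken. *)
Definition rank_strategy : strategy T := fun p x h =>
  if h == silence (delay p x) then Some (par x) else None.

Lemma rank_strategy_legal v : legal v rank_strategy.
Proof.
move=> p x h; rewrite /rank_strategy; case: eqP => // ->.
by rewrite size_nseq /delay; case: v; case: p;
  rewrite //= ?addn0 ?addn1 /= odd_double.
Qed.

Lemma rank_strategy_silence_ends ab p t :
  delay p (seen_vertex ab p) < t -> play rank_strategy ab t <> silence t.
Proof.
move=> lt_t /(play_silent_le lt_t).
rewrite silenceS => /rcons_inj[play_d].
by case: p lt_t play_d => _ play_d; rewrite /rank_strategy play_d eqxx.
Qed.

Lemma rank_strategy_correct : irreflexive e -> correct e rank_strategy.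
Proof.
move=> e_irr [a b] ab p t x; rewrite /announces {1}/rank_strategy.
case: eqP => // play_d [<-]; rewrite /placement /= in ab.
have t_d : t = delay p (seen_vertex (a, b) p).
  by rewrite -(size_play rank_strategy (a, b) t) play_d size_nseq.
(* The speaker has heard only silence, so no player has a shorter delay. *)
have early q :
    ~ delay q (seen_vertex (a, b) q) < delay p (seen_vertex (a, b) p).
  by rewrite -t_d => /rank_strategy_silence_ends; apply; rewrite play_d -t_d.
(* As the ranks differ, the parity offset in [delay] cannot reverse their order: the vertex seen by
   the speaker has the lower rank. *)
have : f a != f b by apply: contraTneq ab => /f_inj->; rewrite e_irr.
case: p {play_d t_d} early => /= early fab; apply: par_up; rewrite // 1?e_sym //.
  by have := early PlayerB; rewrite /delay /=; lia.
by have := early PlayerA; rewrite /delay /=; lia.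
Qed.

Lemma rank_strategy_wins : someone_announces e rank_strategy.
Proof.
move=> ab _.
pose d := delay PlayerA (seen_vertex ab PlayerA).
have : play rank_strategy ab d.+1 != silence d.+1.
  by apply/eqP/(@rank_strategy_silence_ends ab PlayerA).
(* Going back in time from a play that is not silent leads to the first round in which someone
   speaks. *)
elim: d.+1 => // t IHt; rewrite silenceS /=.
have [silent_t|/IHt //] := eqVneq (play rank_strategy ab t) (silence t).
case sA: (rank_strategy PlayerA _ _) => [w|]; first by exists PlayerA, t, w.
case sB: (rank_strategy PlayerB _ _) => [w|]; first by exists PlayerB, t, w.
by rewrite silent_t eqxx.
Qed.

End Strategies.

Theorem theorem2p2 (T : finType) (e : rel T)
    (e_sym : symmetric e) (e_irr : irreflexive e)
    (e_conn : connected_graph e) (v : variant) :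
  (exists s : strategy T,
      [/\ legal v s, correct e s & someone_announces e s])
  <-> is_tree e.
Proof.
split=> [[s [_ s_ok s_win]]|[_ acyc]].
  by split=> //; apply: winning_acyclic s_ok s_win.
have [f [par [f_inj par_up]]] := acyclic_ranking e_sym e_irr acyc.
exists (rank_strategy f par); split.
- exact: rank_strategy_legal.
- exact: rank_strategy_correct.
- exact: rank_strategy_wins.
Qed.
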